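(* For an integer $s\ge2$ let $h_s(x)=x/(1-x)^s$. Then for every $y\in\mathbb{K}[[x]]$, $$\mathcal{D}_{h_s}(y)=\sum_{k=1}^{s-1}\frac{1}{k!}\binom{s-2}{k-1}x^{k-1}y^{(k)},$$ where $y^{(k)}$ is the usual $k$-th derivative of $y$.
   Context: $\mathbb{K}$ is a field of characteristic zero. For $h(x)=\sum_{k\ge1}h_kx^k$ with all $h_k\ne0$, the $h$-derivative is $\mathcal{D}_h\big(\sum_{k\ge0}s_kx^k\big)=\sum_{k\ge1}h_ks_kx^{k-1}$. The usual derivative of formal power series is $\big(\sum_k s_kx^k\big)'=\sum_{k\ge1}ks_kx^{k-1}$. *)

(* Defs.v *)
From HB Require Import structures.
From mathcomp Require Import all_boot all_order all_algebra.
From mathcomp Require Import boolp.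

Set Implicit Arguments.
Unset Strict Implicit.
Unset Printing Implicit Defensive.

Import GRing.Theory.
Local Open Scope ring_scope.

(* The ring K[[x]].  A series is wrapped in a record, rather than being a bare
   function nat -> K, because functions already carry the pointwise product. *)
Record fps (K : fieldType) : Type := FPS { fcoef : nat -> K }.

Section FpsRing.
Variable K : fieldType.
Implicit Types f g h : fps K.

HB.instance Definition _ := gen_eqMixin (fps K).
HB.instance Definition _ := gen_choiceMixin (fps K).

Lemma fpsP f g : (forall n, fcoef f n = fcoef g n) <-> f = g.
Proof.
split=> [|-> //]; case: f => f; case: g => g /= fg.
by congr FPS; apply/funext.
Qed.

Definition fps0 : fps K := FPS (fun _ => 0).
Definition fps_opp f : fps K := FPS (fun n => - fcoef f n).
Definition fps_add f g : fps K := FPS (fun n => fcoef f n + fcoef g n).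

Fact fps_addA : associative fps_add.
Proof. by move=> f g h; apply/fpsP => n /=; rewrite addrA. Qed.
Fact fps_addC : commutative fps_add.
Proof. by move=> f g; apply/fpsP => n /=; rewrite addrC. Qed.
Fact fps_add0 : left_id fps0 fps_add.
Proof. by move=> f; apply/fpsP => n /=; rewrite add0r. Qed.
Fact fps_addN : left_inverse fps0 fps_opp fps_add.
Proof. by move=> f; apply/fpsP => n /=; rewrite addNr. Qed.

HB.instance Definition _ := GRing.isZmodule.Build (fps K)
  fps_addA fps_addC fps_add0 fps_addN.

Definition fps1 : fps K := FPS (fun n => (n == 0%N)%:R).
Definition fps_mul f g : fps K :=
  FPS (fun n => \sum_(i < n.+1) fcoef f i * fcoef g (n - i)%N).

Let trunc n f : {poly K} := \poly_(i < n) fcoef f i.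

Let coef_mul_trunc m n f g : (n < m)%N ->
  fcoef (fps_mul f g) n = (trunc m f * trunc m g)`_n.
Proof.
move=> nm; rewrite coefM /=; apply: eq_bigr => -[i /= le_in] _.
rewrite !coef_poly (leq_trans le_in nm).
by rewrite (leq_ltn_trans (leq_subr _ _) nm).
Qed.

Let coef_mul_low (p p' q q' : {poly K}) n :
  (forall i, (i <= n)%N -> p`_i = p'`_i) ->
  (forall i, (i <= n)%N -> q`_i = q'`_i) -> (p * q)`_n = (p' * q')`_n.
Proof.
move=> pp' qq'; rewrite !coefM; apply: eq_bigr => -[i /= le_in] _.
by rewrite pp' // qq' // leq_subr.
Qed.

Fact fps_mulA : associative fps_mul.
Proof.
move=> f g h; apply/fpsP => n; rewrite !(@coef_mul_trunc n.+1) //.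
transitivity ((trunc n.+1 f * (trunc n.+1 g * trunc n.+1 h))`_n).
  apply: coef_mul_low => // i le_in.
  by rewrite coef_poly ltnS le_in (@coef_mul_trunc n.+1).
rewrite mulrA; apply: coef_mul_low => // i le_in.
by rewrite [RHS]coef_poly ltnS le_in (@coef_mul_trunc n.+1).
Qed.
Fact fps_mulC : commutative fps_mul.
Proof.
by move=> f g; apply/fpsP => n; rewrite !(@coef_mul_trunc n.+1) // mulrC.
Qed.
Fact fps_mul1 : left_id fps1 fps_mul.
Proof.
move=> f; apply/fpsP => n /=; rewrite big_ord_recl /= mul1r subn0.
by rewrite big1 ?addr0 // => i _; rewrite mul0r.
Qed.
Fact fps_mulD : left_distributive fps_mul +%R.
Proof.
move=> f g h; apply/fpsP => n /=; rewrite -big_split /=.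
by apply: eq_bigr => i _; rewrite mulrDl.
Qed.
Fact fps1_neq0 : fps1 != 0.
Proof. by apply/eqP => /fpsP/(_ 0%N)/eqP; rewrite /= oner_eq0. Qed.

HB.instance Definition _ := GRing.Zmodule_isComNzRing.Build (fps K)
  fps_mulA fps_mulC fps_mul1 fps_mulD fps1_neq0.

Definition fps_scale (a : K) f : fps K := FPS (fun n => a * fcoef f n).

Fact fps_scaleA a b f : fps_scale a (fps_scale b f) = fps_scale (a * b) f.
Proof. by apply/fpsP => n /=; rewrite mulrA. Qed.
Fact fps_scale1 : left_id 1 fps_scale.
Proof. by move=> f; apply/fpsP => n /=; rewrite mul1r. Qed.
Fact fps_scaleDr : right_distributive fps_scale +%R.
Proof. by move=> a f g; apply/fpsP => n /=; rewrite mulrDr. Qed.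
Fact fps_scaleDl f : {morph fps_scale^~ f : a b / a + b}.
Proof. by move=> a b; apply/fpsP => n /=; rewrite mulrDl. Qed.

HB.instance Definition _ := GRing.Zmodule_isLmodule.Build K (fps K)
  fps_scaleA fps_scale1 fps_scaleDr fps_scaleDl.

Fact fps_scaleAl (a : K) f g : a *: (f * g) = (a *: f) * g.
Proof.
apply/fpsP => n /=; rewrite mulr_sumr.
by apply: eq_bigr => i _; rewrite mulrA.
Qed.

HB.instance Definition _ := GRing.Lmodule_isLalgebra.Build K (fps K) fps_scaleAl.
HB.instance Definition _ := GRing.Lalgebra_isComAlgebra.Build K (fps K).

(* A series f is a unit iff f_0 != 0; the coefficients g_0, ..., g_n of its
   inverse are obtained by solving f_0 g_n + ... + f_n g_0 = (n == 0). *)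
Definition fps_unit : {pred fps K} := [pred f | fcoef f 0 != 0].

Fixpoint fps_inv_seq f (n : nat) : seq K :=
  if n is m.+1 then
    let s := fps_inv_seq f m in
    rcons s (- (fcoef f 0)^-1 * \sum_(i < m.+1) fcoef f (m.+1 - i)%N * s`_i)
  else [:: (fcoef f 0)^-1].

Definition fps_inv f : fps K :=
  if fcoef f 0 != 0 then FPS (fun n => (fps_inv_seq f n)`_n) else f.

Let size_inv_seq f n : size (fps_inv_seq f n) = n.+1.
Proof. by elim: n => //= n IHn; rewrite size_rcons IHn. Qed.

Let nth_inv_seq f n i : (i <= n)%N ->
  (fps_inv_seq f n)`_i = (fps_inv_seq f i)`_i.
Proof.
elim: n => [|n IHn]; first by rewrite leqn0 => /eqP->.
rewrite leq_eqVlt => /predU1P[-> // | lt_in].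
by rewrite /= nth_rcons size_inv_seq lt_in IHn.
Qed.

Fact fps_mulVf : {in fps_unit, left_inverse 1 fps_inv *%R}.
Proof.
move=> f; rewrite inE => f0; apply/fpsP => n /=; rewrite /fps_inv f0 /=.
case: n => [|n]; first by rewrite big_ord1 /= mulVf.
rewrite big_ord_recr /= subnn nth_rcons size_inv_seq ltnn eqxx.
rewrite mulrAC mulNr mulVf // mulN1r; apply/eqP; rewrite subr_eq0; apply/eqP.
apply: eq_bigr => -[i /= lt_in] _.
by rewrite mulrC (@nth_inv_seq f n).
Qed.
Fact fps_unitPl f g : g * f = 1 -> f \in fps_unit.
Proof.
move/fpsP/(_ 0%N); rewrite /= big_ord1 /= => gf; rewrite inE.
by apply: contra_eq_neq gf => ->; rewrite mulr0 eq_sym oner_neq0.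
Qed.
Fact fps_inv_out : {in [predC fps_unit], fps_inv =1 id}.
Proof. by move=> f; rewrite !inE /fps_inv => /negbTE ->. Qed.

HB.instance Definition _ := GRing.ComNzRing_hasMulInverse.Build (fps K)
  fps_mulVf fps_unitPl fps_inv_out.

Definition fpsX : fps K := FPS (fun n => (n == 1%N)%:R).

Definition fps_deriv f : fps K := FPS (fun n => n.+1%:R * fcoef f n.+1).

Definition fps_derivn (k : nat) f : fps K := iter k fps_deriv f.

(* The series h = \sum_(k >= 1) h_k x^k, with all h_k nonzero, to which an
   h-derivative is attached. *)
Definition admissible h : Prop :=
  fcoef h 0 = 0 /\ forall k, (0 < k)%N -> fcoef h k != 0.

(* Defined for every h, although only meant for admissible ones. *)
Definition hderiv h f : fps K := FPS (fun n => fcoef h n.+1 * fcoef f n.+1).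

Definition hs (s : nat) : fps K := fpsX / (1 - fpsX) ^+ s.

Lemma coef_fpsXM f n : fcoef (fpsX * f) n = if n is m.+1 then fcoef f m else 0.
Proof.
case: n => [|n] /=; first by rewrite big_ord1 /= mul0r.
rewrite big_ord_recl /= mul0r add0r big_ord_recl /= mul1r subSS subn0.
by rewrite big1 ?addr0 // => i _; rewrite mul0r.
Qed.

Lemma one_subX_unit s : (1 - fpsX) ^+ s \is a GRing.unit.
Proof.
apply: unitrX; change (is_true ((1 : K) - 0 != 0)).
by rewrite subr0 oner_neq0.
Qed.

(* h_s does have an h-derivative. *)
Lemma hs_admissible s : [pchar K] =i pred0 -> (0 < s)%N -> admissible (hs s).
Proof.
case: s => // t charK _.
pose b t := FPS (fun n => 'C(n + t, t)%:R) : fps K.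
have bE : (1 - fpsX) ^+ t.+1 * b t = 1.
  elim: t => [|t IHt].
    apply/fpsP => n; rewrite expr1 mulrBl mul1r.
    change (fcoef (b 0%N) n - fcoef (fpsX * b 0%N) n = (n == 0%N)%:R).
    rewrite coef_fpsXM /=.
    by case: n => [|n] /=; rewrite !bin0 ?subr0 ?subrr.
  rewrite exprSr -mulrA -[RHS]IHt; congr (_ * _).
  apply/fpsP => n; rewrite mulrBl mul1r.
  change (fcoef (b t.+1) n - fcoef (fpsX * b t.+1) n = fcoef (b t) n).
  rewrite coef_fpsXM /=.
  case: n => [|n] /=; first by rewrite !add0n !binn subr0.
  by rewrite [in X in X - _]addSn binS addnS natrD addrC addKr addSn.
have -> : hs t.+1 = fpsX * b t.
  apply: (mulrI (one_subX_unit t.+1)).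
  by rewrite [RHS]mulrCA bE mulr1 mulrC divrK // one_subX_unit.
split=> [|[//|k] _]; rewrite coef_fpsXM //=.
by rewrite (pcharf0P _).1 // -lt0n bin_gt0 leq_addl.
Qed.

End FpsRing.

Notation "{ 'fps' K }" := (fps K) (at level 0, format "{ 'fps'  K }") : type_scope.

(* Main.v *)
Require Import Defs.
From mathcomp Require Import all_boot all_order all_algebra.

Import GRing.Theory.
Local Open Scope ring_scope.

(** Both sides act diagonally: the coefficient of [x^n] on the left is
    [C(n+s-1, n) y_{n+1}], and the [k]-th term on the right contributes
    [C(s-2, k-1) C(n+1, k) y_{n+1}], because [x^(k-1) y^(k) / k!] multiplies
    [y_{n+1}] by [C(n+1, k)].  The two agree by Vandermonde's convolution. *)

Section FpsCoefficients.
Variable K : fieldType.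
Implicit Type f : {fps K}.

Lemma fcoef_sum (I : Type) (r : seq I) (P : pred I) (F : I -> {fps K}) n :
  fcoef (\sum_(i <- r | P i) F i) n = \sum_(i <- r | P i) fcoef (F i) n.
Proof. by elim/big_rec2: _ => //= i a g _ <-. Qed.

Lemma coef_fpsXnM k f n :
  fcoef (fpsX K ^+ k * f) n = if (k <= n)%N then fcoef f (n - k) else 0.
Proof.
elim: k n => [|k IHk] n; first by rewrite expr0 mul1r subn0.
by rewrite exprS -mulrA coef_fpsXM; case: n => [|n] //; rewrite IHk subSS.
Qed.

Lemma coef_fps_derivn k f n :
  fcoef (fps_derivn k f) n = ((n + k) ^_ k)%:R * fcoef f (n + k).
Proof.
elim: k n => [|k IHk] n; first by rewrite addn0 ffactn0 mul1r.
rewrite /fps_derivn iterS -/(fps_derivn k f) /= IHk mulrA -natrM addSnnS.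
by rewrite mulnC ffactnSr addnS -addSn addnK.
Qed.

(* For [s = 0] the truncated predecessor still gives the right value, since
   [h_0 = x]. *)
Lemma coef_hs s n : fcoef (hs K s) n.+1 = 'C((n + s).-1, n)%:R.
Proof.
elim: s n => [|s IHs] n.
  rewrite /hs expr0 divr1 /= addn0.
  by case: n => [|n]; rewrite ?bin0 // bin_small.
(* Since [1 - x] is a unit, $h_s = (1-x) h_{s+1}$; comparing coefficients gives a Pascal-type
   recurrence. *)
have hsS m : fcoef (hs K s.+1) m.+1
    = fcoef (hs K s) m.+1 + fcoef (hs K s.+1) m.
  suff -> : hs K s = hs K s.+1 - fpsX K * hs K s.+1.
    change (fcoef (hs K s.+1) m.+1
      = fcoef (hs K s.+1) m.+1 - fcoef (fpsX K * hs K s.+1) m.+1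
        + fcoef (hs K s.+1) m).
    by rewrite coef_fpsXM subrK.
  have U1 := one_subX_unit K 1; have Us := one_subX_unit K s.
  rewrite expr1 in U1.
  rewrite -[X in X - _]mul1r -mulrBl mulrC /hs exprS invrM // -!mulrA.
  by rewrite mulVr // mulr1.
(* The inner induction starts from the zero constant term of $h_{s+1}$; its step is Pascal's
   rule. *)
elim: n => [|n IHn]; rewrite hsS IHs.
  by rewrite !bin0 {1}/hs coef_fpsXM addr0.
by rewrite IHn addSn /= !addnS /= binS natrD.
Qed.

End FpsCoefficients.

(** Vandermonde with the index shifted by one: the term of index 0 contains $C(t, t+1) = 0$, and
    $C(t, t-j) = C(t, j)$ in the others. *)
Lemma sum_bin_succ_bin n t :
  (\sum_(j < t.+1) 'C(n.+1, j.+1) * 'C(t, j) = 'C(n.+1 + t, t.+1))%N.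
Proof.
rewrite -binomial.Vandermonde [RHS]big_ord_recl /= subn0.
rewrite (@bin_small t t.+1) // muln0 add0n.
by apply: eq_bigr => j _; rewrite /= subSS bin_sub // -ltnS.
Qed.

Theorem mainTheorem10 (K : fieldType) (charK : [pchar K] =i pred0)
    (s : nat) (hs_ge2 : (2 <= s)%N) (y : {fps K}) :
  hderiv (hs K s) y =
    \sum_(1 <= k < s)
      ((k`!)%:R^-1 * 'C(s - 2, k - 1)%:R) *: (fpsX K ^+ (k - 1) * fps_derivn k y).
Proof.
case: s hs_ge2 => [|[|t]] // _.
apply/fpsP => n; rewrite fcoef_sum big_add1 big_mkord.
rewrite -[LHS]/(fcoef (hs K t.+2) n.+1 * fcoef y n.+1) coef_hs !addnS /=.
have -> : 'C((n + t).+1, n) = 'C(n.+1 + t, t.+1).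
  by rewrite addSn -bin_sub ?subSn ?leq_addr ?addKn // leqW // leq_addr.
rewrite -sum_bin_succ_bin natr_sum mulr_suml; apply: eq_bigr => j _.
change (('C(n.+1, j.+1) * 'C(t, j))%:R * fcoef y n.+1
  = ((j.+1)`!%:R^-1 * 'C(t.+2 - 2, j.+1 - 1)%:R)
    * fcoef (fpsX K ^+ (j.+1 - 1) * fps_derivn j.+1 y) n).
rewrite !subSS !subn0 coef_fpsXnM coef_fps_derivn.
(* For $j > n$ the factor $x^j$ kills the coefficient on the right, and $C(n+1, j+1) = 0$ on the
   left. *)
case: leqP => [le_jn | lt_nj]; last by rewrite bin_small // mul0n mul0r mulr0.
(* Characteristic zero lets $(j+1)!$ cancel from the falling factorial $C(n+1, j+1) (j+1)!$ produced
   by the derivative. *)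
have fact_neq0 : (j.+1)`!%:R != 0 :> K.
  by rewrite (pcharf0P _).1 // -lt0n fact_gt0.
rewrite addnS subnK // -bin_ffact mulrA natrM natrM; congr (_ * _).
by rewrite [RHS]mulrC [RHS]mulrA mulfK.
Qed.
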